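(* Let $\mathbb{K}$ be a field, $S=\mathbb{K}[x_1,\ldots,x_n]$, and let $\mathcal{G}=\{g_1=\underline{u_{1,1}}-u_{1,2},\ \dots,\ g_s=\underline{u_{s,1}}-u_{s,2}\}$ be a collection of marked homogeneous binomials in $S$ (the underlined monomial is the marked one). Then the following are equivalent: (i) for every monomial $\mu$ in $S$, the directed graph $\Gamma_\mu(\mathcal{G})$ of $\mu$ with respect to $\mathcal{G}$ possesses a unique sink and has no directed cycles; (ii) there exists a monomial order $\tau$ on $S$ such that $\mathcal{G}$ is a Gröbner basis (of the ideal $\langle g_1,\dots,g_s\rangle$) with respect to $\tau$ with the marked monomials as the initial terms, i.e. $\mathrm{in}_\tau(g_i)=u_{i,1}$ for all $i$.
   Context: A marked homogeneous binomial is $g=\underline{u}-u'$ where $u\neq u'$ are monomials of $S$ of the same degree and $u$ is designated as the ''initial term'' of $g$ (either term may be chosen). For a monomial $v$ of $S$, a monomial $w$ is a one step reduction of $v$ with respect to $\mathcal{G}$, written $v\longrightarrow_{\mathcal{G}} w$, if for some $i$ the monomial $u_{i,1}$ divides $v$ and $w=\frac{v}{u_{i,1}}u_{i,2}$. The directed graph $\Gamma_\mu(\mathcal{G})$ of a monomial $\mu$ has as vertices the monomials that can be obtained from $\mu$ by a (possibly empty) sequence of one step reductions with respect to $\mathcal{G}$, and there is a directed edge from a vertex $v$ to a vertex $w$ exactly when $v\longrightarrow_{\mathcal{G}} w$. A sink is a vertex with no outgoing edge. *)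

(* Defs.v *)
From HB Require Import structures.
From mathcomp Require Import all_boot all_order all_algebra.
From mathcomp Require Import mpoly.

Set Implicit Arguments.
Unset Strict Implicit.
Unset Printing Implicit Defensive.

Import GRing.Theory.
Local Open Scope ring_scope.

(* The marked homogeneous binomial  u - u'  with initial term  u = mb_in  and
   other term  u' = mb_tail. *)
Record marked_binomial (n : nat) := MarkedBinomial {
  mb_in : 'X_{1..n};
  mb_tail : 'X_{1..n};
  mb_neq : mb_in != mb_tail;
  mb_homog : mdeg mb_in = mdeg mb_tail
}.

Definition mb_poly (K : fieldType) (n : nat) (g : marked_binomial n) :
  {mpoly K[n]} := 'X_[mb_in g] - 'X_[mb_tail g].

Section ReductionGraph.
Variables (n s : nat) (G : 'I_s -> marked_binomial n).

(* Monomials are exponent vectors: <= is divisibility, and the subtraction is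
   an exact division because it is guarded by that test. *)
Definition one_step : rel 'X_{1..n} := fun v w =>
  [exists i : 'I_s, (mb_in (G i) <= v)%MM &&
     (w == (v - mb_in (G i) + mb_tail (G i))%MM)].

(* The edges of the graph of mu are the pairs of vertices related by
   one_step. *)
Definition graph_vertex (mu v : 'X_{1..n}) : Prop :=
  exists2 p : seq 'X_{1..n}, path one_step mu p & v = last mu p.

Definition graph_sink (mu v : 'X_{1..n}) : Prop :=
  graph_vertex mu v /\ (forall w, graph_vertex mu w -> ~~ one_step v w).

(* Loops, as cycles of length 1, are included; ucycle also accepts the empty
   sequence. *)
Definition graph_directed_cycle (mu : 'X_{1..n}) (c : seq 'X_{1..n}) : Prop :=
  [/\ c != [::], (forall v, v \in c -> graph_vertex mu v) & ucycle one_step c].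

End ReductionGraph.

(* Totality includes reflexivity. *)
Definition monomial_order (n : nat) (le : rel 'X_{1..n}) : Prop :=
  [/\ total le, transitive le, antisymmetric le,
      (forall m, le 0%MM m) &
      (forall m m1 m2, le m1 m2 -> le (m1 + m)%MM (m2 + m)%MM)].

(* The maximum of the support of f; the default value 0 is neutral since it is
   the least monomial of a monomial order. *)
Definition initial_monomial (K : fieldType) (n : nat) (le : rel 'X_{1..n})
    (f : {mpoly K[n]}) : 'X_{1..n} :=
  \big[(fun a b => if le a b then b else a)/0%MM]_(m <- msupp f) m.

Definition ideal_gen (R : comNzRingType) (A : R -> Prop) (f : R) : Prop :=
  exists (k : nat) (c a : 'I_k -> R),
    (forall i, A (a i)) /\ f = \sum_(i < k) c i * a i.

Definition initial_ideal (K : fieldType) (n : nat) (le : rel 'X_{1..n})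
    (I : {mpoly K[n]} -> Prop) : {mpoly K[n]} -> Prop :=
  ideal_gen (fun p => exists f : {mpoly K[n]},
    [/\ I f, f != 0 & p = 'X_[initial_monomial le f]]).

Definition groebner_basis (K : fieldType) (n s : nat) (le : rel 'X_{1..n})
    (I : {mpoly K[n]} -> Prop) (g : 'I_s -> {mpoly K[n]}) : Prop :=
  [/\ (forall i, I (g i)), (forall i, g i != 0) &
      forall f, initial_ideal le I f <->
        ideal_gen (fun p => exists i, p = 'X_[initial_monomial le (g i)]) f].

(* Main.v *)
From HB Require Import structures.
Require Import Defs.
From mathcomp Require Import all_boot all_order all_algebra.
From mathcomp Require Import mpoly ssrcomplements.
From mathcomp Require Import ring lra.

(* (i) => (ii): by Gordan's theorem, either some weight vector is positive on
   all the vectors u_{i,1} - u_{i,2}, or these vectors satisfy a nontrivial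
   relation with nonnegative integer coefficients c_i.  In the second case
   mu = prod_i u_{i,1}^{c_i} = prod_i u_{i,2}^{c_i}, and performing the i-th
   reduction c_i times for each i leads from mu back to mu: a directed cycle.
   In the first case, refine the degree and then the weight to a monomial
   order, for which the marked monomials are initial.  Mapping each monomial to
   its unique sink extends to a linear map which kills the ideal; if the initial
   monomial of f were irreducible, its coefficient in the image of f would be
   the leading coefficient of f.  So the marked monomials generate the initial
   ideal.
   (ii) => (i): reductions strictly decrease the monomial, so there are no
   cycles and sinks exist; the difference of two sinks of mu lies in the ideal,
   yet has an irreducible initial monomial unless it vanishes. *)

Set Implicit Arguments.
Unset Strict Implicit.
Unset Printing Implicit Defensive.

Import Order.TTheory GRing.Theory Num.Theory.

(** * Gordan's alternative for integer vectors *)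

Section Gordan.
Local Open Scope ring_scope.

Lemma separate_point (R : realFieldType) (x : R) (ys : seq R) :
  (forall y, y \in ys -> x < y) ->
  exists2 t, x < t & forall y, y \in ys -> t < y.
Proof.
elim: ys => [|y ys IH] lt_x; first by exists (x + 1); [lra|].
have [|t lt_xt lt_t] := IH.
  by move=> z z_ys; apply: lt_x; rewrite inE z_ys orbT.
have lt_xy : x < y by apply: lt_x; rewrite mem_head.
exists (Num.min t ((x + y) / 2)); first by rewrite lt_min lt_xt /=; lra.
move=> z; rewrite inE gt_min => /predU1P[-> | z_ys]; last by rewrite lt_t.
by apply/orP; right; lra.
Qed.

(** Serves to choose the weight of an eliminated coordinate. Either list may be empty, so the
    induction names no extremal bounds. *)
Lemma separate_seqs (R : realFieldType) (xs ys : seq R) :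
  (forall x y, x \in xs -> y \in ys -> x < y) ->
  exists t, (forall x, x \in xs -> x < t) /\ (forall y, y \in ys -> t < y).
Proof.
elim: xs => [_|x xs IH lt_xy].
  elim: ys => [|y ys [t [_ lt_t]]]; first by exists 0.
  exists (Num.min t (y - 1)); split=> // z.
  rewrite inE gt_min => /predU1P[-> | /lt_t ->] //.
  by apply/orP; right; lra.
have [|t [lt_xs lt_ys]] := IH.
  by move=> z y z_xs; apply: lt_xy; rewrite inE z_xs orbT.
have [lt_xt | le_tx] := ltP x t.
  by exists t; split=> // z; rewrite inE => /predU1P[-> | /lt_xs].
(* Here [x] is at least [t], hence above all of [xs], so clearing [x] is enough. *)
have [|t' lt_xt' lt_t'] := @separate_point _ x ys.
  by move=> y; apply: lt_xy; rewrite mem_head.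
exists t'; split=> // z; rewrite inE => /predU1P[-> // | /lt_xs lt_zt].
by rewrite (lt_trans lt_zt) // (le_lt_trans le_tx).
Qed.

(* Fourier-Motzkin elimination of one coordinate at a time. *)
Lemma gordan_in (I : finType) (s : seq I) :
  uniq s ->
  forall (C : {ffun I -> int} -> Prop) (A : seq {ffun I -> int}),
  (forall x y, C x -> C y -> C (x + y)) ->
  (forall a, a \in A -> C a) ->
  (exists2 v, C v & forall i, i \in s -> v i = 0) \/
  (exists w : I -> rat,
     forall a, a \in A -> 0 < \sum_(i <- s) w i * (a i)%:~R).
Proof.
elim: s => [|i s IH] /= => [_ C [|a A] _ C_A | /andP[i_s s_uniq] C A CD C_A].
- by right; exists (fun=> 0).
- by left; exists a => //; apply: C_A; rewrite mem_head.
have CMn k (x : {ffun I -> int}) : C x -> C (x *+ k.+1).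
  by move=> Cx; elim: k => // k IHk; rewrite mulrS; apply: CD.
(* A combination in which coordinate [i] cancels when [a i] and [b i] have opposite signs. *)
pose comb (a b : {ffun I -> int}) := a *+ `|b i|%N + b *+ `|a i|%N.
pose Pos := [seq a : {ffun I -> int} <- A | 0 < a i].
pose Neg := [seq a : {ffun I -> int} <- A | a i < 0].
pose Zer := [seq a : {ffun I -> int} <- A | a i == 0].
have combC (a b : {ffun I -> int}) :
  0 < a i -> b i < 0 -> C a -> C b -> C (comb a b).
  move=> ai_gt0 bi_lt0 Ca Cb; rewrite /comb.
  (* [C] is not assumed to contain 0, so both multiplicities must be positive. *)
  case: `|a i|%N (absz_gt0 (a i)); first by rewrite gt_eqF.
  case: `|b i|%N (absz_gt0 (b i)); first by rewrite lt_eqF.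
  by move=> ka _ kb _; apply: CD; apply: CMn.
have combE (a b : {ffun I -> int}) j :
  0 < a i -> b i < 0 -> comb a b j = b j * a i - a j * b i.
  move=> ai_gt0 bi_lt0; rewrite /comb ffunE !ffunMnE !pmulrn !mulrzz.
  by rewrite (gtz0_abs ai_gt0) (ltz0_abs bi_lt0); ring.
(* Restricting the semigroup to [v i = 0] lets a relation found on [s] extend to [i]. *)
have [||[v [Cv v_i] v_s]|[w w_gt0]] :=
  IH s_uniq (fun v => C v /\ v i = 0)
    (Zer ++ [seq comb a b | a <- Pos, b <- Neg]).
- by move=> x y [Cx x_i] [Cy y_i]; split; [apply: CD | rewrite ffunE x_i y_i].
- move=> a; rewrite mem_cat => /orP[|/allpairsP[[b c] /= []]].
    by rewrite mem_filter => /andP[/eqP ai0 /C_A].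
  rewrite !mem_filter => /andP[bi_gt0 /C_A Cb] /andP[ci_lt0 /C_A Cc] ->.
  by rewrite combE // mulrC subrr; split=> //; apply: combC.
- left; exists v => // j; rewrite inE => /predU1P[-> //|]; exact: v_s.
right.
pose W (a : {ffun I -> int}) : rat := \sum_(j <- s) w j * (a j)%:~R.
(* Positivity on [a] reads [t * a i + W a > 0]: a lower bound on [t] if [a i > 0], an upper one if
   [a i < 0]. Positivity on the combinations makes these bounds compatible. *)
have [|t [gt_t lt_t]] := @separate_seqs rat
  [seq - W a / (a i)%:~R | a : {ffun I -> int} <- Pos]
  [seq - W b / (b i)%:~R | b : {ffun I -> int} <- Neg].
  move=> _ _ /mapP[a a_Pos ->] /mapP[b b_Neg ->].
  have : 0 < W (comb a b).
    apply: w_gt0; rewrite mem_cat; apply/orP; right.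
    by apply/allpairsP; exists (a, b).
  move: a_Pos b_Neg; rewrite !mem_filter => /andP[ai_gt0 _] /andP[bi_lt0 _].
  have -> : W (comb a b) = W b * (a i)%:~R - W a * (b i)%:~R.
    rewrite /W !mulr_suml -sumrB; apply: eq_bigr => j _.
    by rewrite combE // rmorphB !rmorphM /=; ring.
  move: ai_gt0 bi_lt0; rewrite -(ltr0z rat) -(ltrz0 rat) => ai_gt0 bi_lt0 Wab.
  by rewrite ltr_pdivrMr // mulrAC ltr_ndivlMr //; lra.
exists (fun j => if j == i then t else w j) => a a_A.
rewrite big_cons eqxx.
have -> : \sum_(j <- s) (if j == i then t else w j) * (a j)%:~R = W a.
  apply: eq_big_seq => j j_s; case: eqP => // ji.
  by rewrite -ji j_s in i_s.
have [ai_lt0 | ai_gt0 | ai0] := ltgtP (a i) 0.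
- have : t < - W a / (a i)%:~R.
    by apply: lt_t; apply/mapP; exists a; rewrite // mem_filter ai_lt0.
  by rewrite ltr_ndivlMr ?ltrz0 //; lra.
- have : - W a / (a i)%:~R < t.
    by apply: gt_t; apply/mapP; exists a; rewrite // mem_filter ai_gt0.
  by rewrite ltr_pdivrMr ?ltr0z //; lra.
by rewrite ai0 mulr0 add0r w_gt0 // mem_cat mem_filter ai0 eqxx a_A.
Qed.

(* [C] stands for the semigroup generated by [A]; any larger one will do. *)
Theorem gordan (I : finType) (C : {ffun I -> int} -> Prop)
    (A : seq {ffun I -> int}) :
  (forall x y, C x -> C y -> C (x + y)) ->
  (forall a, a \in A -> C a) ->
  C 0 \/ exists w : I -> rat, forall a, a \in A -> 0 < \sum_i w i * (a i)%:~R.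
Proof.
move=> CD C_A.
have [[v Cv v0] | [w w_gt0]] := gordan_in (index_enum_uniq I) CD C_A.
  left; suff <- : v = 0 by [].
  by apply/ffunP => i; rewrite ffunE v0 ?mem_index_enum.
by right; exists w.
Qed.

End Gordan.

(** After its first step, the walk back to [x] is shortened to a simple path; the first edge then
    closes it. *)
Lemma ucycle_of_closed_path (T : eqType) (e : rel T) (x : T) (p : seq T) :
  p != [::] -> path e x p -> last x p = x ->
  exists c, [/\ c != [::], ucycle e c & {subset c <= p}].
Proof.
case: p => // y p _ /= /andP[e_xy]; case/shortenP=> q e_q q_uniq q_p last_q.
exists (y :: q); split=> //.
  by rewrite /ucycle q_uniq andbT /cycle rcons_path e_q last_q.
by move=> z; rewrite !inE => /predU1P[-> | /q_p ->]; rewrite ?eqxx ?orbT.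
Qed.

(** * Walks and sinks of the reduction graph *)

Section Reduction.
Variables (n s : nat) (G : 'I_s -> marked_binomial n).
Implicit Types (m v w mu : 'X_{1..n}) (p : seq 'X_{1..n}).

Definition irreducible v := [forall i, ~~ (mb_in (G i) <= v)%MM].

(** The cofactor [m] replaces the truncated subtraction. *)
Lemma one_stepP v w :
  reflect (exists i m, v = (m + mb_in (G i))%MM /\ w = (m + mb_tail (G i))%MM)
          (one_step G v w).
Proof.
apply: (iffP existsP) => [[i /andP[le_v /eqP->]] | [i [m [-> ->]]]]; exists i.
  by exists (v - mb_in (G i))%MM; rewrite submK.
by rewrite lem_addl addmK eqxx.
Qed.

Lemma one_step_in i : one_step G (mb_in (G i)) (mb_tail (G i)).
Proof. by apply/one_stepP; exists i, 0%MM; rewrite !add0m. Qed.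

Lemma one_stepD m v w : one_step G v w -> one_step G (v + m)%MM (w + m)%MM.
Proof.
case/one_stepP=> i [m' [-> ->]]; apply/one_stepP; exists i, (m' + m)%MM.
by rewrite -!addmA ![(_ + m)%MM]addmC !addmA.
Qed.

Lemma one_step_mdeg v w : one_step G v w -> mdeg w = mdeg v.
Proof. by case/one_stepP=> i [m [-> ->]]; rewrite !mdegD mb_homog. Qed.

Lemma one_step_neq v w : one_step G v w -> v != w.
Proof. by case/one_stepP=> i [m [-> ->]]; rewrite eqm_add2l mb_neq. Qed.

Lemma irreducible_step v w : irreducible v -> one_step G v w = false.
Proof.
by move/forallP=> irr; apply/existsP => -[i /andP[le_v _]]; case/negP: (irr i).
Qed.

Lemma path_shift m v p :
  path (one_step G) v p ->
  path (one_step G) (v + m)%MM [seq (w + m)%MM | w <- p].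
Proof.
elim: p v => //= w p IH v /andP[step_vw path_w].
by rewrite one_stepD ?IH.
Qed.

Lemma graph_vertex_refl mu : graph_vertex G mu mu.
Proof. by exists [::]. Qed.

Lemma graph_vertex_step mu v w :
  one_step G mu v -> graph_vertex G v w -> graph_vertex G mu w.
Proof. by move=> step_v [p path_p ->]; exists (v :: p); rewrite //= step_v. Qed.

Lemma graph_vertex_mem mu p v :
  path (one_step G) mu p -> v \in p -> graph_vertex G mu v.
Proof.
move=> path_p v_p; case/path.splitP: v_p path_p => p1 p2; rewrite cat_path.
by case/andP=> path_p1 _; exists (rcons p1 v); rewrite ?last_rcons.
Qed.

(** A reduct of a vertex is again a vertex, so whether a vertex is a sink does not depend on
    [mu]. *)
Lemma graph_sinkP mu v :
  graph_sink G mu v <-> graph_vertex G mu v /\ irreducible v.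
Proof.
split=> [[mu_v sink_v] | [mu_v irr_v]]; split=> //; last first.
  by move=> w _; rewrite irreducible_step.
apply/forallP => i; apply/negP => le_v.
pose w := (v - mb_in (G i) + mb_tail (G i))%MM.
have step_v : one_step G v w by apply/existsP; exists i; rewrite le_v eqxx.
suff /sink_v/negP[] : graph_vertex G mu w by [].
case: mu_v => p path_p vE; exists (rcons p w); last by rewrite last_rcons.
by rewrite rcons_path path_p -vE.
Qed.

(* Nonempty walks can be added, so a positive relation between the vectors
   [u_1 - u_2] closes up to a directed cycle. *)
Lemma acyclic_weights :
  (forall mu, ~ exists c, graph_directed_cycle G mu c) ->
  exists w : 'I_n -> rat, forall i,
    (\sum_j w j * (mb_tail (G i) j)%:R < \sum_j w j * (mb_in (G i) j)%:R)%R.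
Proof.
move=> acyclic.
(* Displacements of nonempty walks: displacement zero then means a genuine closed walk. *)
pose C (d : {ffun 'I_n -> int}) := exists v p, [/\ p != [::],
  path (one_step G) v p & d = [ffun j => (v j)%:Z - (last v p j)%:Z]%R].
pose A := [seq [ffun j => (mb_in (G i) j)%:Z - (mb_tail (G i) j)%:Z]%R
          | i : 'I_s].
have [||[v [p [p0 path_p d0]]]|[w w_gt0]] := @gordan _ C A.
- move=> _ _ [v [p [p0 path_p ->]]] [w [q [q0 path_q ->]]].
  (* Walk along [p] with [w] as a passive factor, then along [q] with the endpoint of [p] as one. *)
  exists (v + w)%MM.
  exists ([seq (m + w)%MM | m <- p] ++ [seq (m + last v p)%MM | m <- q]).
  have lastE : last (v + w)%MM [seq (m + w)%MM | m <- p] = (w + last v p)%MM.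
    by rewrite (last_map (fun m => (m + w)%MM)) addmC.
  split; first by case: p p0 {path_p lastE}.
    by rewrite cat_path lastE !path_shift.
  apply/ffunP => j; rewrite last_cat lastE.
  rewrite (last_map (fun m => (m + last v p)%MM)) !ffunE !mnmDE !PoszD; ring.
- move=> _ /mapP[i _ ->]; exists (mb_in (G i)), [:: mb_tail (G i)].
  by split; rewrite //= one_step_in.
- have last_p : last v p = v.
    apply/mnmP => j; have /ffunP/(_ j) := d0; rewrite !ffunE.
    by move/esym/eqP; rewrite subr_eq0 => /eqP[].
  have [c [c0 cyc_c c_p]] := ucycle_of_closed_path p0 path_p last_p.
  by case: (acyclic v); exists c; split=> // m /c_p; apply: graph_vertex_mem.
exists w => i; rewrite -subr_gt0 -sumrB.
have := w_gt0 [ffun j => (mb_in (G i) j)%:Z - (mb_tail (G i) j)%:Z]%R.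
have -> : [ffun j => (mb_in (G i) j)%:Z - (mb_tail (G i) j)%:Z]%R \in A.
  by apply: map_f; rewrite mem_enum.
move=> /(_ isT); congr (_ < _)%R; apply: eq_bigr => j _.
by rewrite ffunE intrB mulrBr.
Qed.

(** * Termination under a monomial order *)

Section Order.
Variable tau : rel 'X_{1..n}.
Hypothesis tau_order : monomial_order tau.
Hypothesis tau_in : forall i, tau (mb_tail (G i)) (mb_in (G i)).

Lemma one_step_le v w : one_step G v w -> tau w v.
Proof.
have [_ _ _ _ tauD] := tau_order.
by case/one_stepP=> i [m [-> ->]]; rewrite ![(m + _)%MM]addmC tauD.
Qed.

Lemma path_le v p : path (one_step G) v p -> tau (last v p) v.
Proof.
have [tau_total tau_trans _ _ _] := tau_order.
elim: p v => [|w p IH] v /=; first by case/orP: (tau_total v v).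
by case/andP=> /one_step_le le_wv /IH /tau_trans; apply.
Qed.

Lemma graph_vertex_le mu v : graph_vertex G mu v -> tau v mu.
Proof. by case=> p /path_le le_p ->. Qed.

(** The path and its closing edge compare the two ends in opposite ways, so that edge would be a
    loop, which distinct terms exclude. *)
Lemma order_acyclic mu : ~ exists c, graph_directed_cycle G mu c.
Proof.
have [_ _ tau_anti _ _] := tau_order.
case=> -[[]//|v p [_ _ /andP[/= ]]].
rewrite rcons_path => /andP[path_p step_v] _.
have /eqP := one_step_neq step_v; apply; apply: tau_anti.
by rewrite path_le // one_step_le.
Qed.

(* Homogeneity keeps the reductions inside the finite set of monomials of a
   given degree, which makes [tau] well-founded there. *)
Lemma normal_form_exists mu : {v | graph_vertex G mu v & irreducible v}.
Proof.
have [tau_total tau_trans tau_anti _ _] := tau_order.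
have [d] := ubnP (mdeg mu).
(* The degree bound [d] stays fixed; the induction is on the size of this finite set. *)
pose below v := [set m : 'X_{1..n < d} | tau m v].
have [k] := ubnP #|below mu|; elim: k mu => // k IH mu le_k lt_d.
case: (pickP (fun i => mb_in (G i) <= mu)%MM) => [i le_mu | irr_mu]; last first.
  exists mu; first exact: graph_vertex_refl.
  by apply/forallP => i; rewrite irr_mu.
pose w := (mu - mb_in (G i) + mb_tail (G i))%MM.
have step_mu : one_step G mu w by apply/existsP; exists i; rewrite le_mu eqxx.
have [||v w_v irr_v] := IH w; last 1 first.
- by exists v => //; apply: graph_vertex_step w_v.
- rewrite ltnS in le_k; apply: leq_trans le_k; apply: proper_card.
  apply/properP; split.
    apply/subsetP => m; rewrite !inE => /tau_trans; apply.
    exact: one_step_le.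
  (* [mu] lies in its own set but not in that of its reduct [w]. *)
  exists (BMultinom lt_d); rewrite !inE /=; first by case/orP: (tau_total mu mu).
  apply: contraNN (one_step_neq step_mu) => le_mu_w; apply/eqP/tau_anti.
  by rewrite le_mu_w one_step_le.
- by rewrite (one_step_mdeg step_mu).
Qed.

End Order.
End Reduction.

(* Comparing degrees first makes 1 the least monomial whatever the signs of
   the weights. *)
Definition weight_order (n : nat) (w : 'I_n -> rat) : rel 'X_{1..n} :=
  fun m1 m2 =>
    let key m : nat *l (rat *l 'X_{1..n}) :=
      (mdeg m, (\sum_j w j * (m j)%:R, m))%R in
    (key m1 <= key m2)%O.

Lemma weight_order_monomial (n : nat) (w : 'I_n -> rat) :
  monomial_order (weight_order w).
Proof.
split.
- by move=> m1 m2; apply: le_total.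
- by move=> m1 m2 m3; apply: le_trans.
(* The last component of the key is the monomial itself, so the key is injective. *)
- by move=> m1 m2 /le_anti[].
- move=> m; rewrite /weight_order lexi_pair leEnat mdeg0 leq0n leqn0 /=.
  apply/implyP; rewrite mdeg_eq0 => /eqP->; exact: lexx.
move=> m m1 m2; rewrite /weight_order !lexi_pair !leEnat.
have wD m' : (\sum_j w j * ((m' + m)%MM j)%:R =
              \sum_j w j * (m' j)%:R + \sum_j w j * (m j)%:R)%R.
  by rewrite -big_split; apply: eq_bigr => j _; rewrite mnmDE natrD mulrDr.
by rewrite !mdegD !leq_add2r !wD !lerD2r lemc_add2l.
Qed.

(** The two terms of a homogeneous binomial tie in degree, so the weight decides. *)
Lemma weight_orderW (n : nat) (w : 'I_n -> rat) (m1 m2 : 'X_{1..n}) :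
  mdeg m1 = mdeg m2 -> (\sum_j w j * (m1 j)%:R < \sum_j w j * (m2 j)%:R)%R ->
  weight_order w m1 m2.
Proof.
move=> eq_deg lt_w.
by rewrite /weight_order !lexi_pair eq_deg lexx (ltW lt_w) leNgt lt_w.
Qed.

(** * Ideals given by generators *)

Section IdealGen.
Local Open Scope ring_scope.
Variables (R : comNzRingType) (A : R -> Prop).

Lemma ideal_gen_ind (P : R -> Prop) :
  P 0 -> (forall c a f, A a -> P f -> P (c * a + f)) ->
  forall f, ideal_gen A f -> P f.
Proof.
move=> P0 PD f [k [c [a [A_a ->]]]].
elim: k c a A_a => [|k IH] c a A_a; first by rewrite big_ord0.
by rewrite big_ord_recl; apply: PD => //; apply: IH => i; apply: A_a.
Qed.

Lemma ideal_gen0 : ideal_gen A 0.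
Proof.
by exists 0, (fun=> 0), (fun=> 0); split; [case | rewrite big_ord0].
Qed.

Lemma ideal_genMD c a f : A a -> ideal_gen A f -> ideal_gen A (c * a + f).
Proof.
move=> A_a [k [c' [a' [A_a' ->]]]].
exists k.+1, (fun i => oapp c' c (unlift ord0 i)),
  (fun i => oapp a' a (unlift ord0 i)).
split; first by move=> i; case: unliftP => [j|] _ /=.
rewrite big_ord_recl unlift_none /=; congr (_ + _).
by apply: eq_bigr => i _; rewrite liftK.
Qed.

Lemma ideal_genD f g : ideal_gen A f -> ideal_gen A g -> ideal_gen A (f + g).
Proof.
move=> I_f I_g; elim/ideal_gen_ind: I_f; rewrite ?add0r // => c a f' A_a I_f'.
by rewrite -addrA; apply: ideal_genMD.
Qed.

Lemma ideal_genM c f : ideal_gen A f -> ideal_gen A (c * f).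
Proof.
elim/ideal_gen_ind => [|c' a f' A_a]; first by rewrite mulr0; apply: ideal_gen0.
by rewrite mulrDr mulrA; apply: ideal_genMD.
Qed.

Lemma ideal_genW a : A a -> ideal_gen A a.
Proof.
by move=> A_a; rewrite -[a]mul1r -[_ * _]addr0; apply: ideal_genMD ideal_gen0.
Qed.

End IdealGen.

Lemma ideal_gen_sub (R : comNzRingType) (A B : R -> Prop) :
  (forall a, A a -> ideal_gen B a) -> forall f, ideal_gen A f -> ideal_gen B f.
Proof.
move=> AB f; elim/ideal_gen_ind => [|c a f' /AB B_a B_f'].
  exact: ideal_gen0.
by apply: ideal_genD B_f'; apply: ideal_genM.
Qed.

(** * Initial monomials and monomial ideals *)

Section InitialMonomial.
Variables (K : fieldType) (n : nat) (le : rel 'X_{1..n}).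
Hypothesis le_order : monomial_order le.
Implicit Types f : {mpoly K[n]}.

Lemma initial_monomial_max f m : m \in msupp f -> le m (initial_monomial le f).
Proof.
have [le_total le_trans _ _ _] := le_order.
rewrite /initial_monomial; elim: (msupp f) => // m' r IH.
rewrite big_cons inE; set M := bigop _ r _ in IH * => /predU1P[-> | /IH le_m].
  by case: ifP => // _; case/orP: (le_total m' m').
case: ifP => // nle_m'; apply: le_trans le_m _.
by have := le_total m' M; rewrite nle_m'.
Qed.

(** If the maximum is the default 0, every monomial of the support lies below it, hence equals it, 0
    being least. *)
Lemma initial_monomial_mem f : f != 0%R -> initial_monomial le f \in msupp f.
Proof.
have [_ _ le_anti le0 _] := le_order.
rewrite -msupp_eq0.
have : initial_monomial le f \in 0%MM :: msupp f.
  rewrite /initial_monomial; elim: (msupp f) => [|m r IH].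
    by rewrite big_nil mem_head.
  rewrite big_cons; case: ifP => _; last by rewrite !inE eqxx orbT.
  by move: IH; rewrite !inE orbCA => ->; rewrite orbT.
rewrite inE => /predU1P[init0 | //].
case: (msupp f) (@initial_monomial_max f) => // m r le_init _.
suff <- : m = initial_monomial le f by apply: mem_head.
by apply: le_anti; rewrite le_init ?mem_head // init0 le0.
Qed.

End InitialMonomial.

Section MonomialIdeal.
Local Open Scope ring_scope.
Variables (R : idomainType) (n : nat) (I : Type) (u : I -> 'X_{1..n}).
Let monomials (p : {mpoly R[n]}) := exists i, p = 'X_[u i].

(** Every monomial of a multiple of ['X_[u i]] is divisible by [u i], and sums create no new
    monomials. *)
Lemma monomial_ideal_msupp (f : {mpoly R[n]}) m :
  ideal_gen monomials f -> m \in msupp f -> exists i, (u i <= m)%MM.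
Proof.
move=> I_f; elim/ideal_gen_ind: I_f m => [m | c _ f' [i ->] IH m].
  by rewrite mcoeff_msupp mcoeff0 eqxx.
move/msuppD_le; rewrite mem_cat => /orP[|/IH //].
by rewrite (perm_mem (msuppMX _ _)) => /mapP[m' _ ->]; exists i; apply: lem_addr.
Qed.

Lemma monomial_ideal_mem i m :
  (u i <= m)%MM -> ideal_gen monomials 'X_[m].
Proof.
move=> le_m; rewrite -(submK le_m) mpolyXD; apply: ideal_genM.
by apply: ideal_genW; exists i.
Qed.

End MonomialIdeal.

(** * Linear extension of maps on monomials *)

Section LinearExtension.
Local Open Scope ring_scope.
Variables (R : idomainType) (n : nat) (V : lmodType R) (phi : 'X_{1..n} -> V).

Definition mlift (p : {mpoly R[n]}) : V := \sum_(m <- msupp p) p@_m *: phi m.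

(** Bounding the degree gives several polynomials a common index set, on which linearity is checked
    termwise. *)
Lemma mliftwE k p : (msize p <= k)%N ->
  mlift p = \sum_(m : 'X_{1..n < k}) p@_m *: phi m.
Proof.
move=> le_k; set I : subFinType _ := 'X_{1..n < k}.
rewrite /mlift (big_mksub I) ?msupp_uniq //=; last first.
  by move=> m /msize_mdeg_lt /leq_trans; apply.
by rewrite big_rmcond //= => m /memN_msupp_eq0 ->; rewrite scale0r.
Qed.

Fact mlift_is_linear : linear mlift.
Proof.
move=> c p q; pose k := maxn (msize (c *: p + q)) (maxn (msize p) (msize q)).
rewrite !(@mliftwE k) ?leq_max ?leqnn ?orbT // scaler_sumr -big_split /=.
by apply: eq_bigr => m _; rewrite linearP scalerDl scalerA.
Qed.

HB.instance Definition _ :=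
  GRing.isLinear.Build R {mpoly R[n]} V *:%R mlift mlift_is_linear.

Lemma mliftX m : mlift 'X_[m] = phi m.
Proof. by rewrite /mlift msuppX big_seq1 mcoeffX eqxx scale1r. Qed.

End LinearExtension.

(** * Unique sinks and the Gröbner property *)

Section Groebner.
Local Open Scope ring_scope.
Variables (K : fieldType) (n s : nat) (G : 'I_s -> marked_binomial n).
Let in_G (p : {mpoly K[n]}) := exists i, p = mb_poly K (G i).

Lemma mb_poly_neq0 (g : marked_binomial n) : mb_poly K g != 0.
Proof.
rewrite -msupp_eq0; apply/negP => /eqP supp0.
have : mb_in g \notin msupp (mb_poly K g) by rewrite supp0.
rewrite mcoeff_msupp negbK mcoeffB !mcoeffX eqxx [mb_tail g == _]eq_sym.
by rewrite (negPf (mb_neq g)) subr0 oner_eq0.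
Qed.

Lemma mem_msupp_mb_poly (g : marked_binomial n) m :
  (m \in msupp (mb_poly K g)) = (m == mb_in g) || (m == mb_tail g).
Proof.
rewrite mcoeff_msupp mcoeffB !mcoeffX ![_ == m]eq_sym.
have [-> | _] := eqVneq m (mb_in g).
  by rewrite (negPf (mb_neq g)) subr0 oner_eq0.
by rewrite sub0r oppr_eq0; case: (m == mb_tail g); rewrite ?oner_eq0 ?eqxx.
Qed.

(** The difference telescopes along the walk, each edge contributing a monomial multiple of a
    generator. *)
Lemma graph_vertex_ideal mu v :
  graph_vertex G mu v -> ideal_gen in_G ('X_[mu] - 'X_[v]).
Proof.
case=> p path_p ->; elim: p mu path_p => [|w p IH] mu /=.
  by move=> _; rewrite subrr; apply: ideal_gen0.
case/andP=> /one_stepP[i [m [-> ->]]] /IH I_w.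
rewrite -(subrKA 'X_[m + mb_tail (G i)]); apply: ideal_genD I_w.
rewrite !mpolyXD -mulrBr; apply: ideal_genM; apply: ideal_genW; by exists i.
Qed.

Variable tau : rel 'X_{1..n}.
Hypothesis tau_order : monomial_order tau.

Lemma initial_mb_polyP (g : marked_binomial n) :
  initial_monomial tau (mb_poly K g) = mb_in g <-> tau (mb_tail g) (mb_in g).
Proof.
have [_ _ tau_anti _ _] := tau_order.
have init_max := initial_monomial_max tau_order (f := mb_poly K g).
split=> [init_in | le_tail].
  by rewrite -init_in init_max // mem_msupp_mb_poly eqxx orbT.
have := initial_monomial_mem tau_order (mb_poly_neq0 g).
rewrite mem_msupp_mb_poly => /orP[/eqP // | /eqP init_tail].
have := init_max (mb_in g); rewrite init_tail mem_msupp_mb_poly eqxx.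
by move=> /(_ isT) le_in; apply: tau_anti; rewrite le_tail le_in.
Qed.

Hypothesis tau_in :
  forall i, initial_monomial tau (mb_poly K (G i)) = mb_in (G i).
Let tau_tail i : tau (mb_tail (G i)) (mb_in (G i)).
Proof. exact/initial_mb_polyP/tau_in. Qed.

Let groebner := groebner_basis tau (ideal_gen in_G) (fun i => mb_poly K (G i)).

Lemma groebner_unique_sink : groebner -> forall mu, exists! v, graph_sink G mu v.
Proof.
case=> _ _ init_eq mu.
have [v mu_v irr_v] := normal_form_exists tau_order tau_tail mu.
exists v; split; first by apply/graph_sinkP.
move=> w /graph_sinkP[mu_w irr_w]; apply/eqP; apply: contraT => neq_vw.
pose f : {mpoly K[n]} := 'X_[v] - 'X_[w].
have I_f : ideal_gen in_G f.
  rewrite /f -(subrKA 'X_[mu]) addrC; apply: ideal_genD.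
    exact: graph_vertex_ideal.
  by rewrite -opprB -mulN1r; apply: ideal_genM; apply: graph_vertex_ideal.
have f_neq0 : f != 0.
  rewrite subr_eq0; apply: contraNneq neq_vw => /(congr1 (mcoeff v)).
  by rewrite !mcoeffX eqxx eq_sym; case: eqP => // _ /eqP; rewrite oner_eq0.
have init_f : initial_ideal tau (ideal_gen in_G) 'X_[initial_monomial tau f].
  by apply: ideal_genW; exists f.
have [|i] := monomial_ideal_msupp (m := initial_monomial tau f)
  ((init_eq _).1 init_f); first by rewrite msuppX mem_head.
rewrite tau_in => le_init.
have := initial_monomial_mem tau_order f_neq0.
move/msuppB_le; rewrite !msuppX !inE => /orP[]/eqP init_vw.
  by move/forallP/(_ i): irr_v; rewrite -init_vw le_init.
by move/forallP/(_ i): irr_w; rewrite -init_vw le_init.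
Qed.

(* Sending every monomial to its normal form kills the ideal, so the initial
   monomial of an element of the ideal cannot be its own normal form. *)
Lemma unique_sink_reducible f :
  (forall mu, exists! v, graph_sink G mu v) ->
  ideal_gen in_G f -> f != 0 -> ~~ irreducible G (initial_monomial tau f).
Proof.
move=> sink_uniq I_f f_neq0; apply/negP => irr_f.
have [_ _ tau_anti _ _] := tau_order.
pose nf mu := s2val (normal_form_exists tau_order tau_tail mu).
have nfP mu : graph_vertex G mu (nf mu) /\ irreducible G (nf mu).
  by rewrite /nf; case: normal_form_exists.
have nf_uniq mu v : graph_vertex G mu v -> irreducible G v -> nf mu = v.
  move=> mu_v irr_v; have [v0 [_ v0_uniq]] := sink_uniq mu.
  by rewrite -(v0_uniq v) ?(v0_uniq (nf mu)) //; apply/graph_sinkP.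
pose L := @mlift K n {mpoly K[n]} (fun m => 'X_[nf m]).
have L0 : L f = 0.
  elim/ideal_gen_ind: I_f => [|c _ f' [i ->] L_f']; first exact: linear0.
  (* Once [c] is expanded, each product has two terms joined by an edge, hence with the same normal
     form. *)
  rewrite /L linearD /= -/(L f') L_f' addr0 [c]mpolyE mulr_suml /L linear_sum /=.
  apply: big1 => m _; rewrite -scalerAl linearZ /= mulrBr -!mpolyXD linearB /=.
  rewrite !mliftX (_ : nf _ = nf (m + mb_tail (G i))%MM) ?subrr ?scaler0 //.
  have [w_nf irr_nf] := nfP (m + mb_tail (G i))%MM.
  apply: nf_uniq irr_nf; apply: graph_vertex_step w_nf.
  by apply/one_stepP; exists i, m.
set m0 := initial_monomial tau f in irr_f.
have m0_f : m0 \in msupp f := initial_monomial_mem tau_order f_neq0.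
have := congr1 (mcoeff m0) L0; rewrite mcoeff0 /L /mlift raddf_sum /=.
rewrite (bigD1_seq m0) //= mcoeffZ mcoeffX (nf_uniq m0 m0) //; last first.
  exact: graph_vertex_refl.
(* Another [m] of the support with normal form [m0] would be above [m0] by reduction and below it by
   maximality. *)
rewrite eqxx mulr1 big_seq_cond big1 ?addr0; last first.
  move=> m /andP[m_f neq_m]; rewrite mcoeffZ mcoeffX.
  case: eqP => [nf_m | _]; last by rewrite mulr0.
  case/eqP: neq_m; apply: tau_anti.
  rewrite (initial_monomial_max tau_order m_f) -/m0 -nf_m.
  by rewrite (graph_vertex_le tau_order tau_tail) //; case: (nfP m).
by apply/eqP; rewrite -mcoeff_msupp.
Qed.

Lemma unique_sink_groebner :
  (forall mu, exists! v, graph_sink G mu v) -> groebner.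
Proof.
move=> sink_uniq; split=> [i|i|f]; first by apply: ideal_genW; exists i.
  exact: mb_poly_neq0.
split; apply: ideal_gen_sub => a [].
  move=> h [I_h h_neq0 ->].
  have := unique_sink_reducible sink_uniq I_h h_neq0.
  rewrite negb_forall => /existsP[i]; rewrite negbK -tau_in.
  exact: (@monomial_ideal_mem _ _ _
            (fun i => initial_monomial tau (mb_poly K (G i)))).
move=> i ->; apply: ideal_genW; exists (mb_poly K (G i)); split=> //.
  by apply: ideal_genW; exists i.
exact: mb_poly_neq0.
Qed.

End Groebner.

Theorem theorem2p5 (K : fieldType) (n s : nat) (G : 'I_s -> marked_binomial n) :
  (forall mu : 'X_{1..n},
     (exists! v : 'X_{1..n}, graph_sink G mu v) /\
     ~ (exists c : seq 'X_{1..n}, graph_directed_cycle G mu c))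
  <->
  (exists tau : rel 'X_{1..n},
     [/\ monomial_order tau,
         groebner_basis tau
           (ideal_gen (fun p : {mpoly K[n]} => exists i, p = mb_poly K (G i)))
           (fun i => mb_poly K (G i)) &
         forall i, initial_monomial tau (mb_poly K (G i)) = mb_in (G i)]).
Proof.
split=> [sink_acyclic | [tau [tau_order groebner tau_in]] mu].
  (* Acyclicity yields the order, uniqueness of sinks the Gröbner property. *)
  have [|w lt_w] := @acyclic_weights _ _ G.
    by move=> mu; case: (sink_acyclic mu).
  have tau_order := weight_order_monomial w.
  have tau_in i :
    initial_monomial (weight_order w) (mb_poly K (G i)) = mb_in (G i).
    by apply/initial_mb_polyP => //; apply: weight_orderW; rewrite ?mb_homog.
  exists (weight_order w); split=> //.
  by apply: unique_sink_groebner => // mu; case: (sink_acyclic mu).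
split; first exact: (groebner_unique_sink tau_order tau_in groebner).
apply: (order_acyclic tau_order) => i.
exact/(initial_mb_polyP K tau_order)/tau_in.
Qed.
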